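(* Let $r\geqslant 2$, $\ell\geqslant 1$ with $\gcd(r,\ell)\in\{1,2\}$, and set $m=2^r(2^\ell+1)$, $d=(m-2)/2$, $e=\binom{(d-1)/2}{2}$. For every $n\geqslant 1$ and every $f=\sum_{k=0}^{m}a_{m-k}x^k\in\mathbb F_{2^n}[x]$ with $a_0\neq 0$ and $a_1\neq 0$, the number of $\alpha\in\overline{\mathbb F}_2^*$ such that $L_\alpha f$ does not have distinct critical values (i.e. $\Pi_d(L_\alpha f)=0$) is at most $(5d+4)e$.
   Context: For $m\equiv 0\pmod 4$, $d=(m-2)/2$, $f$ of degree at most $m$ and $\alpha\neq 0$, $L_\alpha f$ is the unique polynomial of degree at most $d$ such that $(L_\alpha f)(x(x+\alpha))=f(x+\alpha)+f(x)$; when $a_1\neq 0$ it has degree exactly $d$ with leading coefficient $b_0=a_1\alpha$. For $d$ odd and $g=\sum_{k=0}^{d}b_{d-k}x^k$ of degree $d$ in characteristic 2, write $g'=b_0\prod_{i=1}^{(d-1)/2}(x+\tau_i)^2$ and $\Pi_d(g)=\prod_{i\neq j}(g(\tau_i)-g(\tau_j))$; $g$ has distinct critical values iff $\Pi_d(g)\neq 0$ (distinct roots of $g'$ give distinct values of $g$). *)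

(* Defs.v *)
From HB Require Import structures.
From mathcomp Require Import all_boot all_order all_algebra.
Set Implicit Arguments. Unset Strict Implicit. Unset Printing Implicit Defensive.
Import GRing.Theory.
Local Open Scope ring_scope.

Definition mdeg (r l : nat) : nat := (2 ^ r * (2 ^ l + 1))%N.
Definition ddeg (m : nat) : nat := ((m - 2) %/ 2)%N.
Definition edeg (d : nat) : nat := 'C((d - 1) %/ 2, 2).

Definition in_F2n (K : fieldType) (n : nat) (x : K) : Prop := x ^+ (2 ^ n) = x.

Definition in_F2bar (K : fieldType) (x : K) : Prop :=
  exists k : nat, (0 < k)%N /\ x ^+ (2 ^ k) = x.

Definition is_L (K : fieldType) (d : nat) (alpha : K) (f g : {poly K}) : Prop :=
  (size g <= d.+1)%N /\
  g \Po ('X * ('X + alpha%:P)) = f \Po ('X + alpha%:P) + f.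

Definition Pi_zero (K : fieldType) (d : nat) (g : {poly K}) : Prop :=
  exists tau : 'I_((d - 1) %/ 2) -> K,
    g^`() = g`_d *: \prod_(i < (d - 1) %/ 2) ('X + (tau i)%:P) ^+ 2 /\
    \prod_(i < (d - 1) %/ 2) \prod_(j < (d - 1) %/ 2 | i != j)
       (g.[tau i] - g.[tau j]) = 0.

Definition bad_alpha (K : fieldType) (d : nat) (f : {poly K}) (alpha : K) : Prop :=
  exists g, is_L d alpha f g /\ Pi_zero d g.

(* Main.v *)
From HB Require Import structures.
From mathcomp Require Import all_boot all_order all_fingroup all_algebra.
From mathcomp Require Import ring zify.
From mathcomp Require Import mpoly.
(* After [mpoly], which has its own [mdeg]. *)
Require Import Defs.
Import GRing.Theory.
Local Open Scope ring_scope.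
Set Implicit Arguments. Unset Strict Implicit. Unset Printing Implicit Defensive.

(** Let [U_k] be the Lucas polynomials in characteristic 2, so that
    [a U_k(a)(x(x+a)) = (x+a)^k + x^k].  Then [L_a f = a * sum_k f_k U_k(a)],
    and [(L_a f)'(y) = a f_(m-1) h(y^2)] where [h] is monic of degree
    [s = (d-1)/2] with coefficients polynomial in [A = a^2].  The critical
    points are the square roots of the roots [T_i] of [h], so the square of
    [Pi_d (L_a f)] is, up to a power of [a], the product over [i <> j] of
    [G(T_i) - G(T_j)], where [G] is [L_a f / a] with squared coefficients.  By
    symmetry in the [T_i], this product is a polynomial [P] in [A].  Rescaling
    [y] turns the family at [A] into a family at [1/A] that is polynomial
    around [A = oo], so [P] is nonzero of degree [(m-1)s(s-1) = (4d+2)e] as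
    soon as the family at infinity, [h = U_d(1)] and [G = a_0^2 U_m(1)], has
    distinct critical values.  Writing the roots of [U_d(1)] as [x(x+1)],
    this is a statement on the equation [(x+1)^d = x^d], in which the gcd
    condition enters through [F_(2^r) :&: F_(2^l)] being contained in [F_4]. *)

(** Reduces an identity of characteristic 2 to one that [ring] proves; [z] collects terms that
    cancel in pairs. *)
Lemma pchar2_eq (R : comNzRingType) (x y z : R) :
  (2 \in [pchar R])%N -> x = y + (z + z) -> x = y.
Proof. by move=> c2 ->; rewrite (addrr_pchar2 c2) addr0. Qed.

(** * Frobenius powers and the equation [(x+1)^d = x^d] *)

Section Frobenius.
Variables (K : fieldType) (c2 : (2 \in [pchar K])%N).

Lemma frobD n (x y : K) : (x + y) ^+ (2 ^ n) = x ^+ (2 ^ n) + y ^+ (2 ^ n).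
Proof.
by apply: exprDn_pchar; rewrite pnatX; apply/orP; left; rewrite pnatE.
Qed.

Lemma frob_inj n (x y : K) : x ^+ (2 ^ n) = y ^+ (2 ^ n) -> x = y.
Proof.
move=> e; have : (x + y) ^+ (2 ^ n) = 0 by rewrite frobD e (addrr_pchar2 c2).
move/eqP; rewrite expf_eq0 => /andP[_]; rewrite addr_eq0 (oppr_pchar2 c2).
by move/eqP.
Qed.

Lemma frob_fixM a b (x : K) : x ^+ (2 ^ a) = x -> x ^+ (2 ^ (b * a)) = x.
Proof.
by move=> e; elim: b => [|b IH]; rewrite ?expr1 // mulSn expnD exprM e.
Qed.

Lemma frob_fix_gcd r l (x : K) : (0 < r)%N ->
  x ^+ (2 ^ r) = x -> x ^+ (2 ^ l) = x -> x ^+ (2 ^ gcdn r l) = x.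
Proof.
move=> r0 er el; case: (egcdnP l r0) => km kn e _.
have := frob_fixM km er; rewrite e expnD exprM.
by rewrite (frob_fixM kn el).
Qed.

(** Either [x1 + x2] lies in F_2, or [x1] and [x2] both lie in F_4 outside F_2, where [x * (x + 1)]
    is 1. *)
Lemma critical_value_inj r l (x1 x2 : K) :
  (gcdn r.+1 l == 1)%N || (gcdn r.+1 l == 2)%N ->
  let d := (2 ^ r * (2 ^ l + 1)).-1 in
  (x1 + 1) ^+ d = x1 ^+ d -> (x2 + 1) ^+ d = x2 ^+ d ->
  x1 ^+ (2 ^ l) + x1 = x2 ^+ (2 ^ l) + x2 ->
  x1 * (x1 + 1) = x2 * (x2 + 1).
Proof.
move=> hg d e1 e2 e12.
have N0 : (0 < 2 ^ r * (2 ^ l + 1))%N by rewrite muln_gt0 expn_gt0 addn1.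
have d0 : (0 < d)%N.
  by rewrite -ltnS prednK // (@leq_mul 1 2) ?expn_gt0 // addn1 ltnS expn_gt0.
have two (z : K) : z + z = 0 by apply: addrr_pchar2.
have ne (x : K) : (x + 1) ^+ d = x ^+ d -> x != 0 /\ x + 1 != 0.
  move=> e; split; apply/negP=> /eqP z; move: e; rewrite z ?add0r expr0n ?expr1n.
    by rewrite (gtn_eqF d0) /= => /eqP; rewrite oner_eq0.
  rewrite (gtn_eqF d0); have -> : x = 1.
    by apply/eqP; rewrite -(oppr_pchar2 c2 1) -addr_eq0 z.
  by rewrite /= expr1n => /eqP; rewrite eq_sym oner_eq0.
(* For fixed [c], the equation [(x+1)^d = x^d] becomes additive in [x]; hence
   it also holds for [v = x1 + x2], and for [c0] once [c] is known to be fixed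
   by the [2^l]-power map. *)
pose c0 := x1 ^+ (2 ^ l) + x1; pose c := c0 ^+ (2 ^ r).
have lin x : (x + 1) ^+ d = x ^+ d -> x ^+ (2 ^ l) + x = c0 ->
   (x ^+ (2 ^ r)) ^+ 2 + c * x ^+ (2 ^ r) + (c + 1) * x = 0.
  move=> e ec.
  have h : x * (x + 1) ^+ d.+1 = (x + 1) * x ^+ d.+1 by rewrite !exprS e; ring.
  have yQ : (x ^+ (2 ^ r)) ^+ (2 ^ l) = x ^+ (2 ^ r) + c.
    by rewrite /c -ec frobD -!exprM mulnC addrCA two addr0.
  move: h; rewrite /d prednK // !exprM !exprD !expr1 frobD expr1n frobD expr1n yQ.
  move: (x ^+ (2 ^ r)) => y h.
  apply: (@pchar2_eq _ _ _ (y ^+ 2 + c * y - x * y) c2); rewrite add0r.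
  rewrite -[LHS]subr0; have -> : 0 = x * ((y + c + 1) * (y + 1)) - (x + 1) * ((y + c) * y).
    by rewrite h subrr.
  ring.
have /= l1 := lin x1 e1 erefl; have /= l2 := lin x2 e2 (esym e12).
have [n1 m1] := ne _ e1; have [n2 m2] := ne _ e2.
pose v := x1 + x2.
have x2E : x2 = x1 + v by rewrite /v addrA two add0r.
have vQ : v ^+ (2 ^ l) = v.
  by apply/eqP; rewrite -subr_eq0 (oppr_pchar2 c2) frobD addrACA e12 two.
clearbody v.
have lv : (v ^+ (2 ^ r)) ^+ 2 + c * v ^+ (2 ^ r) + (c + 1) * v = 0.
  move: l1 l2; rewrite x2E frobD.
  move: (x1 ^+ (2 ^ r)) (v ^+ (2 ^ r)) => y z l1 l2.
  have := congr2 +%R l1 l2; rewrite addr0 => <-.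
  by apply: (@pchar2_eq _ _ _ (- (y ^+ 2 + y * z + c * y + (c + 1) * x1)) c2); ring.
have sqfix (z : K) : z ^+ 2 = z -> z = 0 \/ z = 1.
  move=> e; case: (eqVneq z 0) => [|z0]; first by left.
  by right; apply: (mulfI z0); rewrite mulr1 -expr2.
have vFix : v = 0 \/ v = 1 -> x1 * (x1 + 1) = x2 * (x2 + 1).
  rewrite x2E => vv; apply: (@pchar2_eq _ _ _ (- (x1 * v)) c2).
  have vv1 : v * (v + 1) = 0 by case: vv => ->; rewrite ?mul0r // two mulr0.
  by rewrite -[LHS]addr0 -vv1; ring.
(* If the 2^r-power map fixes [v], then [lv] reads [v^2 + v = 0]; otherwise [lv] gives [c] as a
   quotient of elements fixed by the 2^l-power map. *)
have [vq|vq] := eqVneq (v ^+ (2 ^ r)) v.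
  apply/vFix/sqfix; apply: (@pchar2_eq _ _ _ (- (c * v + v)) c2).
  by rewrite -[RHS]addr0 -lv vq; ring.
have cE : c * (v ^+ (2 ^ r) + v) = (v ^+ (2 ^ r)) ^+ 2 + v.
  apply: (@pchar2_eq _ _ _ (- ((v ^+ (2 ^ r)) ^+ 2 + v)) c2).
  by rewrite -[LHS]subr0 -lv; ring.
have vqv : v ^+ (2 ^ r) + v != 0 by rewrite addr_eq0 (oppr_pchar2 c2).
have cQ : c ^+ (2 ^ l) = c.
  have comQ : (v ^+ (2 ^ r)) ^+ (2 ^ l) = v ^+ (2 ^ r) by rewrite -exprM mulnC exprM vQ.
  apply: (mulIf vqv); rewrite cE.
  have := congr1 (fun z => z ^+ (2 ^ l)) cE; rewrite /= exprMn !frobD.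
  rewrite comQ vQ => ->.
  by rewrite -exprM mulnC exprM comQ.
have c0Q : c0 ^+ (2 ^ l) = c0.
  by apply: (@frob_inj r); rewrite -exprM mulnC exprM -/c.
(* Raising [l1] to the power 2^l fixes [c] and sends [x1] to [x1 + c0]; subtract [l1]. *)
have l1Q : (c + 1) * c0 = 0.
  have := congr1 (fun z => z ^+ (2 ^ l)) l1.
  rewrite /= !frobD !exprMn expr0n gtn_eqF ?expn_gt0 // frobD expr1n cQ.
  rewrite (exprAC x1).
  rewrite (_ : x1 ^+ (2 ^ l) = x1 + c0); last by rewrite /c0 addrCA two addr0.
  rewrite frobD -/c; move: l1; move: (x1 ^+ (2 ^ r)) => y l1 l1'.
  have := congr2 (fun a b => a - b) l1' l1; rewrite subrr => <-.
  by apply: (@pchar2_eq _ _ _ (- (y * c + c ^+ 2)) c2); ring.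
(* [c = 1] would put [x1] in F_2, which [ne] excludes; [c0 = 0] makes [x1] and [x2] fixed by the
   powers 2^(r+1) and 2^l, hence elements of F_4. *)
move/eqP: l1Q; rewrite mulf_eq0 addr_eq0 (oppr_pchar2 c2) => /orP[] /eqP ce.
  have : x1 ^+ (2 ^ r) = 0 \/ x1 ^+ (2 ^ r) = 1.
    apply: sqfix; apply: (@pchar2_eq _ _ _ (- (x1 ^+ (2 ^ r) + x1)) c2).
    by rewrite -[LHS]subr0 -l1 ce; ring.
  case=> /eqP; first by rewrite expf_eq0 (negbTE n1) andbF.
  move/eqP; rewrite -(expr1n K (2 ^ r)) => /frob_inj x11.
  by move: m1; rewrite x11 two eqxx.
have c00 : c = 0 by rewrite /c ce expr0n gtn_eqF ?expn_gt0.
have fin x : x != 0 -> x + 1 != 0 -> x ^+ (2 ^ l) + x = c0 ->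
   (x ^+ (2 ^ r)) ^+ 2 + c * x ^+ (2 ^ r) + (c + 1) * x = 0 -> x * (x + 1) = 1.
  move=> n m xQ; rewrite c00 mul0r addr0 add0r mul1r -exprM -expnSr.
  move/eqP; rewrite addr_eq0 (oppr_pchar2 c2) => /eqP xr.
  move: xQ; rewrite ce => /eqP; rewrite addr_eq0 (oppr_pchar2 c2) => /eqP xl.
  have x4 : x ^+ (2 ^ 2) = x.
    have xg := frob_fix_gcd (ltn0Sn r) xr xl.
    by case/orP: hg => /eqP g; move: xg; rewrite g // => xg; rewrite expnS exprM xg.
  have nn : x * (x + 1) != 0 by rewrite mulf_neq0.
  case: (sqfix (x * (x + 1))) => // [|/eqP]; last by rewrite (negbTE nn).
  have -> : (x * (x + 1)) ^+ 2 = x ^+ (2 ^ 2) + x ^+ 2 + x ^+ 3 + x ^+ 3 by ring.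
  rewrite x4.
  by apply: (@pchar2_eq _ _ _ (x ^+ 3) c2); ring.
by rewrite (fin _ n1 m1 erefl l1) (fin _ n2 m2 (esym e12) l2).
Qed.
End Frobenius.

(** * Lucas polynomials *)

(* The usual sign in front of ['X] is dropped: the identities below hold in
   characteristic 2. *)
Fixpoint lucas (R : comNzRingType) (a : R) (k : nat) : {poly R} :=
  if k is k1.+1 then
    if k1 is k2.+1 then a%:P * lucas a k1 + 'X * lucas a k2 else 1
  else 0.

Arguments lucas : simpl never.

Lemma lucasSS (R : comNzRingType) (a : R) k :
  lucas a k.+2 = a%:P * lucas a k.+1 + 'X * lucas a k.
Proof. by []. Qed.

Lemma nat_ind2 (P : nat -> Prop) :
  P 0%N -> P 1%N -> (forall k, P k -> P k.+1 -> P k.+2) -> forall k, P k.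
Proof.
move=> P0 P1 PS k; have [//] : P k /\ P k.+1.
by elim: k => [//|k [IH1 IH2]]; split; last exact: PS.
Qed.

Lemma map_lucas (R S : comNzRingType) (h : {rmorphism R -> S}) (a : R) k :
  map_poly h (lucas a k) = lucas (h a) k.
Proof.
elim/nat_ind2: k => [||k IH0 IH1]; rewrite ?rmorph0 ?rmorph1 //.
by rewrite !lucasSS rmorphD !rmorphM /= IH0 IH1 map_polyC map_polyX.
Qed.

Lemma size_lucas (R : comNzRingType) (a : R) k : (size (lucas a k) <= uphalf k)%N.
Proof.
elim/nat_ind2: k => [||k IH0 IH1]; rewrite ?size_poly0 ?size_poly1 //.
rewrite lucasSS (leq_trans (size_polyD _ _)) // geq_max; apply/andP; split.
  rewrite mul_polyC (leq_trans (size_scale_leq _ _)) // (leq_trans IH1) //.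
  by rewrite leq_uphalf_double; lia.
rewrite mulrC (leq_trans (size_polyMleq _ _)) // size_polyX.
by move: IH0; rewrite /= uphalfE; lia.
Qed.

Lemma lucas_coef_double (R : comNzRingType) (a : R) k :
  (lucas a k.*2.+1)`_k = 1.
Proof.
elim: k => [|k IH]; first by rewrite coef1.
rewrite doubleS lucasSS coefD coefCM coefXM /= IH nth_default ?mulr0 ?add0r //.
by rewrite (leq_trans (size_lucas _ _)) // uphalfE; lia.
Qed.

(** [lucas a k] is isobaric of weight k - 1, with [a] of weight 1 and ['X] of weight 2; the extra
    factor [b] avoids the exponent k - 1. *)
Lemma lucas_scale (R : comNzRingType) (a b : R) k :
  b *: (lucas (b * a) k \Po ((b ^+ 2) *: 'X)) = (b ^+ k) *: lucas a k.
Proof.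
elim/nat_ind2: k => [||k IH0 IH1].
- by rewrite comp_poly0 !scaler0.
- by rewrite comp_polyC.
rewrite !lucasSS comp_polyD !comp_polyM comp_polyX comp_polyC scalerDr.
rewrite scalerAr IH1 scalerAr IH0 -!mul_polyC !exprS !polyCM; ring.
Qed.

Section Char2.
Variables (R : comNzRingType) (c2 : (2 \in [pchar R])%N).
Implicit Types (a x : R) (k : nat).

Lemma poly_pchar2 : (2 \in [pchar {poly R}])%N.
Proof. exact: rmorph_pchar polyC _ c2. Qed.

(** Binet's formula: [x + a] and [x] are the roots of [z^2 = a z + x(x+a)], so their powers satisfy
    the recurrence of [lucas]. *)
Lemma horner_lucas a x k :
  a * (lucas a k).[x * (x + a)] = (x + a) ^+ k + x ^+ k.
Proof.
elim/nat_ind2: k => [||k IH0 IH1].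
- by rewrite hornerE mulr0 (addrr_pchar2 c2).
- rewrite hornerE; apply: (@pchar2_eq _ _ _ (- x) c2); ring.
rewrite lucasSS !hornerE mulrDr mulrCA IH1 mulrCA IH0 !exprS.
by apply: (@pchar2_eq _ _ _ (a * x ^+ k * x) c2); ring.
Qed.

Lemma horner_lucas_sqr a x k :
  (lucas a k).[x] ^+ 2 = (lucas (a ^+ 2) k).[x ^+ 2].
Proof.
elim/nat_ind2: k => [||k IH0 IH1].
- by rewrite !hornerE expr0n.
- by rewrite !hornerE expr1n.
rewrite !lucasSS !(hornerD, hornerM, hornerC, hornerX) -IH0 -IH1.
by apply: (@pchar2_eq _ _ _ (a * (lucas a k.+1).[x] * (x * (lucas a k).[x])) c2); ring.
Qed.

(** Formally the derivative of [horner_lucas] in [x], since [x(x+a)] has derivative [a]; the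
    induction avoids dividing by [a]. *)
Lemma deriv_lucas a k : a *: (lucas a k)^`() = (lucas a k.-1) *+ k.
Proof.
elim/nat_ind2: k => [||k IH0 IH1].
- by rewrite derivC scaler0.
- by rewrite derivC scaler0.
rewrite lucasSS derivD !derivM derivC derivX mul0r add0r mul1r scalerDr scalerDr.
rewrite !scalerAr IH0 IH1 /=.
have c2P := poly_pchar2.
case: k {IH0 IH1} => [|k].
  by rewrite -!mul_polyC /=; apply: (@pchar2_eq _ _ _ (-1) c2P); ring.
rewrite [k.+1.-1]/= lucasSS -!mul_polyC.
apply: (@pchar2_eq _ _ _ (- ('X * lucas a k)) c2P).
rewrite -(mulr_natr _ k.+3) -(mulr_natr _ k.+2) -(mulr_natr _ k.+1) -(natr1 k.+2)
  -(natr1 k.+1) -(natr1 k).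
ring.
Qed.

(** The even case is what makes the derivative of [L_a f] a polynomial in ['X^2]; the odd one
    carries the induction. *)
Lemma lucas_double a k :
  lucas a k.*2 = a *: lucas a k ^+ 2 /\
  lucas a k.*2.+1 = lucas a k.+1 ^+ 2 + 'X * lucas a k ^+ 2.
Proof.
have c2P := poly_pchar2.
elim: k => [|k [IH0 IH1]]; first by rewrite /= expr0n scaler0 mulr0 addr0 expr1n.
have E : lucas a k.+1.*2 = a *: lucas a k.+1 ^+ 2.
  rewrite doubleS lucasSS IH0 IH1 -!mul_polyC.
  by apply: (@pchar2_eq _ _ _ (a%:P * 'X * lucas a k ^+ 2) c2P); ring.
split=> //; rewrite doubleS lucasSS -doubleS E IH1 lucasSS -!mul_polyC.
by apply: (@pchar2_eq _ _ _ (- (a%:P * lucas a k.+1 * 'X * lucas a k)) c2P); ring.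
Qed.
End Char2.

(** * Symmetric functions of the critical points *)

Definition disc (R : comNzRingType) s (G : {poly R}) (T : 'I_s -> R) : R :=
  \prod_(i < s) \prod_(j < s | i != j) (G.[T i] - G.[T j]).

(** The product is symmetric in [T], hence a polynomial in the coefficients of [h]. [P] is chosen
    before [ev], so it serves all specializations at once. *)
Lemma disc_mem_coef_ring (R L : idomainType) s (G h : {poly R}) :
  exists P : R, forall (ev : {rmorphism R -> L}) (T : 'I_s -> L),
    map_poly ev h = \prod_(i < s) ('X - (T i)%:P) ->
    ev P = disc (map_poly ev G) T.
Proof.
pose p : {mpoly R[s]} := disc (map_poly (@mpolyC s R) G) (fun i => 'X_i).
have psym : p \is symmetric.
  apply/issymP => sg; rewrite /p /disc rmorph_prod /=.
  rewrite [RHS](reindex_inj (@perm_inj _ sg)) /=; apply: eq_bigr => i _.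
  rewrite [RHS](reindex_inj (@perm_inj _ sg)) /= rmorph_prod.
  have ev k : msym sg (map_poly (@mpolyC s R) G).['X_k] =
              (map_poly (@mpolyC s R) G).['X_(sg k)].
    rewrite -horner_map /= /msym mmapX mmap1U -map_poly_comp.
    by congr _.[_]; apply: eq_map_poly => c /=; rewrite mmapC.
  by apply: eq_big => [j|j _]; rewrite ?(inj_eq (@perm_inj _ sg)) // rmorphB /= !ev.
(* Vieta's formulas; index [i] stands for the elementary symmetric polynomial of degree [i + 1]. *)
pose v (i : 'I_s) := (-1) ^+ i.+1 * h`_(s - i.+1).
exists (symf p).@[v] => ev T hT.
have -> : disc (map_poly ev G) T = mmap ev T p.
  rewrite /p /disc rmorph_prod; apply: eq_bigr => i _.
  rewrite rmorph_prod; apply: eq_bigr => j _; rewrite rmorphB /=.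
  have evk k : mmap ev T (map_poly (@mpolyC s R) G).['X_k] = (map_poly ev G).[T k].
    rewrite -horner_map /= mmapX mmap1U -map_poly_comp.
    by congr _.[_]; apply: eq_map_poly => c /=; rewrite mmapC.
  by rewrite !evk.
rewrite [p in RHS](symfP psym) mevalE comp_mpolyEX !rmorph_sum /=.
apply: eq_bigr => m _; rewrite mmapZ rmorphM comp_mpolyX !rmorph_prod /=.
congr (_ * _); apply: eq_bigr => i _; rewrite !rmorphXn /= tnth_mktuple.
congr (_ ^+ _).
have := @mroots_coeff L s (mktuple T) (lift ord0 i).
rewrite big_tuple lift0 (eq_bigr (fun i => 'X - (T i)%:P)); last by move=> j _; rewrite tnth_mktuple.
rewrite -hT coef_map /v rmorphM rmorph_sign => ->.
rewrite signrMK /mesym !rmorph_sum /=; apply: eq_bigr => D _.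
rewrite !rmorph_prod /=; apply: eq_bigr => j _.
by rewrite mevalXU tnth_mktuple mmapX mmap1U.
Qed.

(** * The family and its behaviour at infinity *)

(* [B] homogenizes the sum: [B = 1] gives the family in the parameter [A],
   while [A = 1] and [B -> 0] describes it at infinity. *)
Definition fam (R : comNzRingType) N (c : nat -> R) (A B : R) : {poly R} :=
  \sum_(k < N.+1) (c k * B ^+ (N - k)) *: lucas A k.

Lemma map_fam (R S : comNzRingType) (h : {rmorphism R -> S}) N c A B :
  map_poly h (fam N c A B) = fam N (h \o c) (h A) (h B).
Proof.
rewrite /fam rmorph_sum; apply: eq_bigr => k _.
by rewrite /= map_polyZ map_lucas rmorphM rmorphXn.
Qed.

Lemma exprV_sub (K : fieldType) (t : K) M j : t != 0 -> (j <= M)%N ->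
  t ^+ M * t^-1 ^+ (M - j) = t ^+ j.
Proof.
by move=> t0 jM; rewrite -{1}(subnKC jM) exprD exprVn mulfK ?expf_neq0.
Qed.

Lemma fam_scale (K : fieldType) N (c : nat -> K) (A : K) : A != 0 ->
  A *: (fam N c A 1 \Po (A ^+ 2 *: 'X)) = A ^+ N *: fam N c 1 A^-1.
Proof.
move=> A0; rewrite /fam (raddf_sum (comp_poly _)) !scaler_sumr; apply: eq_bigr => k _.
have := lucas_scale 1 A k; rewrite mulr1 => e.
rewrite /= comp_polyZ scalerA [A * _]mulrC -[LHS]scalerA e !scalerA expr1n mulr1; congr (_ *: _).
by rewrite mulrCA exprV_sub // -ltnS.
Qed.

Lemma fam0 (R : comNzRingType) N (c : nat -> R) A : fam N c A 0 = c N *: lucas A N.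
Proof.
rewrite /fam big_ord_recr /= subnn expr0 mulr1 big1 ?add0r // => k _.
by rewrite expr0n subn_eq0 leqNgt ltn_ord mulr0 scale0r.
Qed.

Lemma size_fam (R : comNzRingType) N (c : nat -> R) A B :
  (size (fam N c A B) <= uphalf N)%N.
Proof.
apply: (leq_trans (size_sum _ _ _)); apply/bigmax_leqP => k _.
apply: (leq_trans (size_scale_leq _ _)); apply: (leq_trans (size_lucas _ _)).
by rewrite !uphalfE half_leq // ltnS -ltnS.
Qed.

Lemma coef_fam_double (R : comNzRingType) s (c : nat -> R) A B :
  (fam s.*2.+1 c A B)`_s = c s.*2.+1.
Proof.
rewrite /fam coef_sum big_ord_recr /= coefZ lucas_coef_double subnn expr0 !mulr1.
rewrite big1 ?add0r // => k _; rewrite coefZ nth_default ?mulr0 //.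
apply: (leq_trans (size_lucas _ _)); rewrite uphalfE.
by have := ltn_ord k; lia.
Qed.

(** * Polynomials over an algebraically closed field *)

Lemma monic_split (K : closedFieldType) s (p : {poly K}) :
  (size p <= s.+1)%N -> p`_s = 1 ->
  exists T : 'I_s -> K, p = \prod_(i < s) ('X - (T i)%:P).
Proof.
move=> sp ps; have [r pE] := closed_field_poly_normal p.
have szp : size p = s.+1.
  apply/eqP; rewrite eqn_leq sp ltnNge; apply/negP => le.
  by move: ps; rewrite nth_default // => /eqP; rewrite eq_sym oner_eq0.
have lc : lead_coef p = 1 by rewrite lead_coefE szp.
rewrite lc scale1r in pE.
have sr : size r = s.
  by apply: succn_inj; rewrite -szp pE size_prod_XsubC.
by exists (fun i => r`_i); rewrite pE (big_nth 0) sr big_mkord.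
Qed.

(* The hypothesis says that [Q] is the reversal of [P] in degree [N]. *)
Lemma size_reversed (K : closedFieldType) N (P Q : {poly K}) :
  (forall A, A != 0 -> P.[A] = A ^+ N * Q.[A^-1]) -> Q.[0] != 0 ->
  P != 0 /\ (size P <= N.+1)%N.
Proof.
move=> PQ Q0; pose M := (size P + N)%N.
pose E := \poly_(j < M.+1) P`_(M - j).
have EE : E = 'X^(size P) * Q.
  (* The factor ['X] disposes of the point 0, where the hypothesis says nothing. *)
  have : ('X * (E - 'X^(size P) * Q) == 0).
    apply/negPn/negP => /closed_nonrootP [t].
    rewrite rootE !hornerE; have [->|t0] := eqVneq t 0; first by rewrite mul0r eqxx.
    have -> : E.[t] = t ^+ M * P.[t^-1].
      rewrite horner_poly [P in P.[_]](_ : P = \poly_(i < M.+1) P`_i); last first.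
        apply/polyP => i; rewrite coef_poly; case: ltnP => // li.
        by rewrite nth_default //; apply: leq_trans li; rewrite /M -addnS leq_addr.
      rewrite horner_poly mulr_sumr [RHS](reindex_inj rev_ord_inj) /=.
      apply: eq_bigr => j _; rewrite subSS mulrCA; congr (_ * _).
      by rewrite exprV_sub // -ltnS.
    rewrite PQ ?invr_eq0 // invrK mulrA /M exprD exprVn mulfK ?expf_neq0 //.
    by rewrite subrr mulr0 eqxx.
  by rewrite mulf_eq0 polyX_eq0 subr_eq0 => /eqP.
have co i : (i <= M)%N -> P`_i = if (N < i)%N then 0 else Q`_(N - i).
  move=> iM; have := congr1 (fun p : {poly K} => p`_(M - i)) EE.
  rewrite coef_poly ltnS leq_subr subKn // coefXnM => ->.
  rewrite /M in iM *; have -> : (size P + N - i - size P = N - i)%N by lia.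
  by case: ltnP => h1; case: ltnP => h2 //; exfalso; lia.
split.
  apply/eqP=> P0; have := co N (leq_addl _ _); rewrite P0 coef0 ltnn subnn.
  by rewrite -horner_coef0 => /esym/eqP; rewrite (negbTE Q0).
rewrite leqNgt; apply/negP => lt.
have := co (size P).-1; rewrite -lead_coefE /M.
have -> : (N < (size P).-1)%N by lia.
move=> /(_ ltac:(lia)) /eqP; rewrite lead_coef_eq0 => /eqP P0.
by move: lt; rewrite P0 size_poly0.
Qed.

Lemma artin_schreier_root (K : closedFieldType) (a t : K) : exists x, x * (x + a) = t.
Proof.
have := @solve_monicpoly K 2 (fun i => if i == 0 then t else - a) isT.
case=> x e; exists x; rewrite mulrDr -expr2 e !big_ord_recl big_ord0 /=; ring.
Qed.

(** * Distinct critical values at infinity *)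

Lemma scale_lucas_comp (R : comNzRingType) (c2 : (2 \in [pchar R])%N) (a : R) k :
  a *: (lucas a k \Po ('X * ('X + a%:P))) = ('X + a%:P) ^+ k + 'X ^+ k.
Proof.
by rewrite -(horner_lucas (poly_pchar2 c2)) -mul_polyC -(map_lucas polyC).
Qed.

Lemma lucas_sqr_comp (R : comNzRingType) (c2 : (2 \in [pchar R])%N) (a : R) k :
  lucas a k ^+ 2 = lucas (a ^+ 2) k \Po 'X ^+ 2.
Proof.
have := horner_lucas_sqr (poly_pchar2 c2) a%:P 'X k.
rewrite -polyC_exp -!(map_lucas polyC) => e.
by rewrite -{1}[lucas a k]comp_polyXr.
Qed.

Lemma horner_lucas1_eq0 (K : fieldType) (c2 : (2 \in [pchar K])%N) k (x : K) :
  root (lucas 1 k) (x * (x + 1)) -> (x + 1) ^+ k = x ^+ k.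
Proof.
move=> /rootP r; have := horner_lucas c2 1 x k; rewrite r mulr0 => /esym/eqP.
by rewrite addr_eq0 (oppr_pchar2 c2) => /eqP.
Qed.

(** A double root [x(x+1)] is also a root of the derivative [lucas 1 k.*2]; then [(x+1)^j = x^j] for
    [j = 2k] and [j = 2k+1] forces [x = 0], which is impossible. *)
Lemma lucas_roots_inj (K : closedFieldType) (c2 : (2 \in [pchar K])%N) k s
    (T : 'I_s -> K) : (0 < k)%N ->
  lucas 1 k.*2.+1 = \prod_(i < s) ('X - (T i)%:P) -> injective T.
Proof.
move=> k0 lE i j Tij; apply/eqP/negPn/negP => ij.
have [x xE] := artin_schreier_root 1 (T i).
have r1 : root (lucas 1 k.*2.+1) (x * (x + 1)).
  by rewrite lE xE (bigD1 i) //= rootM root_XsubC eqxx.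
have r2 : root (lucas 1 k.*2) (x * (x + 1)).
  have := deriv_lucas c2 1 k.*2.+1; rewrite scale1r /= mulrS -muln2 mulrnA.
  have -> : lucas (1 : K) (k * 2) *+ k *+ 2 = 0.
    by rewrite mulr2n (addrr_pchar2 (poly_pchar2 c2)).
  rewrite addr0 => <-; rewrite muln2 lE (bigD1 i) //= (bigD1 j) 1?eq_sym //=.
  rewrite rootE !derivM !derivXsubC xE !hornerE -Tij.
  by apply/eqP; ring.
have e1 := horner_lucas1_eq0 c2 r1; have e2 := horner_lucas1_eq0 c2 r2.
have : x ^+ k.*2 == 0.
  move: e1; rewrite !exprS e2 mulrDl mul1r => /eqP.
  by rewrite -subr_eq0 addrC addrA addNr add0r.
rewrite expf_eq0 => /andP[_ /eqP x0]; move: e2.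
rewrite x0 add0r expr1n expr0n double_eq0 gtn_eqF //= => /eqP.
by rewrite oner_eq0.
Qed.

(** The value at [z(z+1)] is [(z^(2^l) + z)^(2^(r+1)) + 1]; injectivity of Frobenius reduces the
    claim to [critical_value_inj]. *)
Lemma lucas_values_inj (K : closedFieldType) (c2 : (2 \in [pchar K])%N) r l k s
    (T : 'I_s -> K) : (0 < k)%N ->
  (gcdn r.+1 l == 1)%N || (gcdn r.+1 l == 2)%N ->
  k.*2.+1 = (2 ^ r * (2 ^ l + 1)).-1 ->
  lucas 1 k.*2.+1 = \prod_(i < s) ('X - (T i)%:P) ->
  injective (fun i => (lucas 1 (2 ^ r.+1 * (2 ^ l + 1))).[T i]).
Proof.
move=> k0 hg kE lE i j /= e.
apply: (lucas_roots_inj c2 k0 lE).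
have [x xE] := artin_schreier_root 1 (T i).
have [y yE] := artin_schreier_root 1 (T j).
have rt i' z : z * (z + 1) = T i' ->
    (z + 1) ^+ (2 ^ r * (2 ^ l + 1)).-1 = z ^+ (2 ^ r * (2 ^ l + 1)).-1.
  move=> zE; rewrite -kE; apply: (horner_lucas1_eq0 c2).
  by rewrite lE zE (bigD1 i') //= rootM root_XsubC eqxx.
rewrite -xE -yE; apply: (critical_value_inj c2 hg (rt _ _ xE) (rt _ _ yE)).
have val i' z : z * (z + 1) = T i' ->
   (lucas 1 (2 ^ r.+1 * (2 ^ l + 1))).[T i'] = (z ^+ (2 ^ l) + z) ^+ (2 ^ r.+1) + 1.
  move=> <-; have := horner_lucas c2 1 z (2 ^ r.+1 * (2 ^ l + 1)).
  rewrite mul1r => ->; rewrite !exprM !exprD !expr1 (frobD c2 r.+1) expr1n.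
  rewrite !(frobD c2) expr1n (exprAC z).
  by apply: (@pchar2_eq _ _ _ ((z ^+ (2 ^ l)) ^+ (2 ^ r.+1) * z ^+ (2 ^ r.+1)) c2); ring.
apply: (@frob_inj _ c2 r.+1); apply: (@addIr _ 1).
by rewrite -(val _ _ xE) -(val _ _ yE).
Qed.

(** * The polynomial in [A], its nonvanishing and its degree *)

Lemma map_horner_fam (R : comNzRingType) N (c : nat -> R) (p q : {poly R}) (x : R) :
  map_poly (horner_eval x) (fam N (fun k => (c k)%:P) p q) = fam N c p.[x] q.[x].
Proof.
rewrite map_fam /fam; apply: eq_bigr => k _ /=.
by rewrite !horner_evalE hornerC.
Qed.

Lemma disc_scale (R : comNzRingType) s (F G : {poly R}) (T U : 'I_s -> R) (a : R) :
  (forall i, F.[T i] = a * G.[U i]) ->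
  disc F T = a ^+ (s.-1 * s) * disc G U.
Proof.
move=> FG; rewrite /disc.
have -> : a ^+ (s.-1 * s) = \prod_(i < s) a ^+ s.-1.
  by rewrite prodr_const card_ord exprM.
rewrite -big_split /=; apply: eq_bigr => i _.
have -> : a ^+ s.-1 = \prod_(j < s | i != j) a.
  rewrite prodr_const; congr (_ ^+ _); have := cardC1 i; rewrite card_ord => <-.
  by apply: eq_card => j; rewrite !inE eq_sym.
rewrite -big_split /=; apply: eq_bigr => j _.
by rewrite !FG mulrBr.
Qed.

Lemma disc_eq0 (R : idomainType) s (G : {poly R}) (T : 'I_s -> R) :
  reflect (exists i j, i != j /\ G.[T i] = G.[T j]) (disc G T == 0).
Proof.
apply: (iffP (prodf_eq0 _ _)) => [[i _ /prodf_eq0[j ij]]|[i [j [ij e]]]].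
  by rewrite subr_eq0 => /eqP; exists i, j.
by exists i => //; apply/prodf_eq0; exists j; rewrite ?e ?subrr.
Qed.

Lemma disc_fam_poly (K : closedFieldType) m s (b c : nat -> K) :
  (0 < m)%N -> c s.*2.+1 = 1 ->
  (forall T : 'I_s -> K, lucas 1 s.*2.+1 = \prod_(i < s) ('X - (T i)%:P) ->
     injective (fun i => (b m *: lucas 1 m).[T i])) ->
  exists P : {poly K},
  [/\ P != 0, (size P <= (m.-1 * (s.-1 * s)).+1)%N &
      forall A (T : 'I_s -> K),
        fam s.*2.+1 c A 1 = \prod_(i < s) ('X - (T i)%:P) ->
        P.[A] = disc (fam m b A 1) T].
Proof.
move=> m0 cd inj.
(* Over the coefficient ring [{poly K}], ['X] plays the role of [A] in [P] and of [B] in [Q]. *)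
have [P HP] := @disc_mem_coef_ring {poly K} K s (fam m (fun k => (b k)%:P) 'X 1)
   (fam s.*2.+1 (fun k => (c k)%:P) 'X 1).
have [Q HQ] := @disc_mem_coef_ring {poly K} K s (fam m (fun k => (b k)%:P) 1 'X)
   (fam s.*2.+1 (fun k => (c k)%:P) 1 'X).
have {}HP A T : fam s.*2.+1 c A 1 = \prod_(i < s) ('X - (T i)%:P) ->
   P.[A] = disc (fam m b A 1) T.
  by have := HP (horner_eval A) T; rewrite !map_horner_fam hornerX hornerC.
have {}HQ A T : fam s.*2.+1 c 1 A = \prod_(i < s) ('X - (T i)%:P) ->
   Q.[A] = disc (fam m b 1 A) T.
  by have := HQ (horner_eval A) T; rewrite !map_horner_fam hornerX hornerC.
have split A B : exists T : 'I_s -> K, fam s.*2.+1 c A B = \prod_(i < s) ('X - (T i)%:P).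
  apply: monic_split; last by rewrite coef_fam_double cd.
  by apply: (leq_trans (size_fam _ _ _ _)); rewrite uphalfE; lia.
suff [P0 sP] : P != 0 /\ (size P <= (m.-1 * (s.-1 * s)).+1)%N by exists P.
apply: (@size_reversed _ _ P Q) => [A A0|]; last first.
  have [T hT] := split 1 0; rewrite (HQ _ _ hT).
  apply/negP => /disc_eq0 [i [j [ij]]]; rewrite fam0 => /inj e.
  by move: ij; rewrite e ?eqxx // -hT fam0 cd scale1r.
have [T hT] := split A 1; rewrite (HP _ _ hT).
have A20 : A ^+ 2 != 0 by rewrite expf_neq0.
(* Rescaling divides the roots by [A^2], and each of the s(s-1) differences of values contributes a
   factor A^(m-1). *)
have hU : fam s.*2.+1 c 1 A^-1 = \prod_(i < s) ('X - (T i / A ^+ 2)%:P).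
  have := fam_scale s.*2.+1 c A0; rewrite hT rmorph_prod /=.
  rewrite (eq_bigr (fun i => (A ^+ 2)%:P * ('X - (T i / A ^+ 2)%:P))); last first.
    move=> i _; rewrite comp_polyB comp_polyX comp_polyC mulrBr mul_polyC -polyCM.
    by rewrite mulrC mulfVK.
  rewrite big_split /= prodr_const card_ord -polyC_exp mul_polyC scalerA -exprM mul2n -exprS.
  by move/scalerI => ->; rewrite ?expf_neq0.
rewrite (HQ _ _ hU) exprM; apply: disc_scale => i.
have := congr1 (fun p : {poly K} => p.[T i / A ^+ 2]) (fam_scale m b A0).
rewrite /= !hornerZ horner_comp hornerZ hornerX mulrC mulrC.
rewrite [A ^+ 2 * _]mulrC divfK // => e; apply: (mulfI A0).
by rewrite e mulrA -exprS prednK.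
Qed.

(** * From [L_a f] to the family *)

Lemma poly_sum_le (R : nzRingType) N (p : {poly R}) : (size p <= N)%N ->
  p = \sum_(k < N) p`_k *: 'X ^+ k.
Proof.
move=> sp; rewrite -poly_def; apply/polyP => i; rewrite coef_poly.
by case: ltnP => // le; rewrite nth_default // (leq_trans sp).
Qed.

(** Composition with ['X * ('X + a)] is injective, and after it [scale_lucas_comp] compares the two
    sides termwise. *)
Lemma L_fam (K : fieldType) (c2 : (2 \in [pchar K])%N) d m (a : K) (f g : {poly K}) :
  (size f <= m.+1)%N -> is_L d a f g ->
  g = a *: fam m (fun k => f`_k) a 1.
Proof.
move=> sf [_ gE]; apply/eqP; rewrite -subr_eq0.
have sq : (1 < size ('X * ('X + a%:P) : {poly K})%R)%N.
  by rewrite mulrC size_mulX ?size_XaddC // -size_poly_gt0 size_XaddC.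
rewrite -(comp_poly_eq0 _ sq) comp_polyB gE subr_eq0; apply/eqP.
rewrite {1 2}(poly_sum_le sf) comp_polyZ /fam !(raddf_sum (comp_poly _)) /=.
rewrite -big_split scaler_sumr; apply: eq_bigr => k _ /=.
rewrite !comp_polyZ expr1n mulr1 comp_Xn_poly.
rewrite scalerA mulrC -scalerA scale_lucas_comp //.
by rewrite scalerDr.
Qed.

Lemma sum_lucas_odd (R : comNzRingType) (c2 : (2 \in [pchar R])%N) (c : nat -> R) a n :
  \sum_(k < n.*2.+1) c k *: (lucas a k.-1 *+ k) =
  \sum_(j < n) c j.*2.+1 *: lucas a j.*2.
Proof.
have c2P := poly_pchar2 c2.
have ev (p : {poly R}) j : p *+ j.*2 = 0.
  by rewrite -mul2n mulrnA mulr2n (addrr_pchar2 c2P) mul0rn.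
elim: n => [|n IH]; first by rewrite big_ord1 big_ord0 mulr0n scaler0.
rewrite doubleS [LHS]big_ord_recr [RHS]big_ord_recr /= [X in X + _]big_ord_recr /=.
rewrite IH -doubleS ev scaler0 addr0.
by rewrite mulrSr ev add0r.
Qed.

Lemma deriv_L (K : fieldType) (c2 : (2 \in [pchar K])%N) d (b : nat -> K) (a : K) :
  b d.*2.+1 != 0 ->
  (a *: fam d.*2.+2 b a 1)^`() =
  (a * b d.*2.+1) *: (fam d (fun j => b j.*2.+1 / b d.*2.+1) (a ^+ 2) 1 \Po 'X ^+ 2).
Proof.
move=> bd; rewrite derivZ /fam raddf_sum scaler_sumr.
rewrite (eq_bigr (fun k : 'I_d.*2.+3 => b k *: (lucas a k.-1 *+ k))) => [|k _ /=].
  rewrite -doubleS (sum_lucas_odd c2) (raddf_sum (comp_poly _)) scaler_sumr.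
  apply: eq_bigr => j _ /=.
  rewrite (lucas_double c2 a j).1 (lucas_sqr_comp c2) comp_polyZ !scalerA.
  by congr (_ *: _); rewrite expr1n mulr1; field.
by rewrite derivZ expr1n mulr1 scalerA mulrC -scalerA deriv_lucas.
Qed.

(** Moves critical values to the parameter [a^2], in which [deriv_L] describes the critical
    points. *)
Lemma fam_sqr (K : fieldType) (c2 : (2 \in [pchar K])%N) m (b : nat -> K) (a t : K) :
  (fam m b a 1).[t] ^+ 2 = (fam m (fun k => b k ^+ 2) (a ^+ 2) 1).[t ^+ 2].
Proof.
rewrite /fam !horner_sum (big_morph (fun x => x ^+ 2) (@frobD _ c2 1) (expr0n _ 2)).
apply: eq_bigr => k _.
by rewrite !hornerZ !expr1n !mulr1 exprMn (horner_lucas_sqr c2).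
Qed.

(** * Counting the bad parameters *)

Theorem theorem3p5 (K : closedFieldType) (charK : (2 \in [pchar K])%N)
  (r l n : nat) (hr : (2 <= r)%N) (hl : (1 <= l)%N)
  (hgcd : (gcdn r l == 1)%N || (gcdn r l == 2)%N) (hn : (1 <= n)%N)
  (f : {poly K})
  (hfF : forall k : nat, in_F2n n f`_k)
  (hsize : (size f <= (mdeg r l).+1)%N)
  (ha0 : f`_(mdeg r l) != 0)
  (ha1 : f`_((mdeg r l).-1) != 0) :
  forall s : seq K, uniq s ->
    (forall alpha, alpha \in s ->
       [/\ alpha != 0, in_F2bar alpha & bad_alpha (ddeg (mdeg r l)) f alpha]) ->
    (size s <= (5 * ddeg (mdeg r l) + 4) * edeg (ddeg (mdeg r l)))%N.
Proof.
case: r hr hgcd hsize ha0 ha1 => [//|[//|r]] _ hg sf a0 a1 t ut bad.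
(* The number (d-1)/2 of critical points, [r] having been lowered by 2. *)
pose s := (2 ^ r * (2 ^ l + 1)).-1.
have w0 : (1 < 2 ^ r * (2 ^ l + 1))%N.
  by rewrite (@leq_mul 1 2) ?expn_gt0 // addn1 ltnS expn_gt0.
have sE : s.*2.+1 = (2 ^ r.+1 * (2 ^ l + 1)).-1 by rewrite /s expnS -mulnA; lia.
have mE : mdeg r.+2 l = s.*2.+1.*2.+2 by rewrite /mdeg /s 2!expnS -!mulnA; lia.
have dE : ddeg (mdeg r.+2 l) = s.*2.+1 by rewrite /ddeg mE; lia.
have s0 : (0 < s)%N by rewrite /s; lia.
have sd : ((s.*2.+1 - 1) %/ 2)%N = s by lia.
rewrite dE in bad *; rewrite /edeg sd.
pose d := s.*2.+1; pose m := d.*2.+2.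
rewrite mE -/d -/m /= in sf a0 a1.
have inj (T : 'I_s -> K) : lucas 1 d = \prod_(i < s) ('X - (T i)%:P) ->
   injective (fun i => (f`_m ^+ 2 *: lucas 1 m).[T i]).
  move=> hT i j /=; rewrite !hornerZ => /mulfI -/(_ _)/= e.
  apply: (lucas_values_inj charK s0 hg sE hT).
  by rewrite -/(mdeg r.+2 l) mE; apply: e; rewrite expf_neq0.
have [P [P0 sP HP]] := @disc_fam_poly K m s (fun k => f`_k ^+ 2)
   (fun j => f`_j.*2.+1 / f`_d.*2.+1) isT (divff a1) inj.
have rootP alpha : alpha \in t -> root P (alpha ^+ 2).
  case/bad=> al0 _ [g [gL]]; have gE := L_fam charK sf gL.
  rewrite /Pi_zero; move: gL gE; rewrite -/d => gL gE [].
  rewrite [((d - 1) %/ 2)%N]sd => tau [gd /eqP g0].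
  have hT : fam d (fun j => f`_j.*2.+1 / f`_d.*2.+1) (alpha ^+ 2) 1 =
        \prod_(i < s) ('X - (tau i ^+ 2)%:P).
    have gD := deriv_L charK alpha a1; rewrite -[_.*2.+2]/m -gE in gD.
    set h := fam _ _ _ _ in gD *.
    have hs : (h \Po 'X ^+ 2)`_(s.*2) = 1.
      rewrite coef_comp_poly_Xn // -muln2 dvdn_mull // mulnK //.
      by rewrite /h /d coef_fam_double divff.
    (* As [d] is odd, the coefficient of degree [2s = d - 1] in the derivative is that of degree [d]
       in [g]. *)
    have lead : g`_d = alpha * f`_d.*2.+1.
      have := congr1 (fun p : {poly K} => p`_s.*2) gD.
      rewrite /= coef_deriv coefZ hs mulr1 => <-.
      by rewrite mulrSr -mul2n mulrnA mulr2n (addrr_pchar2 charK) mul0rn add0r mul2n.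
    move: gd; rewrite gD lead => /scalerI; rewrite mulf_neq0 // => /(_ isT) hE.
    have sX : (1 < size ('X ^+ 2 : {poly K})%R)%N by rewrite size_polyXn.
    apply/eqP; rewrite -subr_eq0 -(comp_poly_eq0 _ sX) comp_polyB hE subr_eq0.
    rewrite rmorph_prod /=; apply/eqP/eq_bigr => i _.
    rewrite comp_polyB comp_polyX comp_polyC polyC_exp.
    by apply: (@pchar2_eq _ _ _ ('X * (tau i)%:P + (tau i)%:P ^+ 2) (poly_pchar2 charK)); ring.
  rewrite rootE (HP _ _ hT); apply/eqP/eqP/disc_eq0.
  have /disc_eq0 [i [j [ij e]]] : disc g tau == 0 by [].
  exists i, j; split=> //.
  move: e; rewrite gE !hornerZ => /(mulfI al0) e.
  by rewrite -!(fam_sqr charK) e.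
have sqinj : injective (fun x : K => x ^+ 2) by exact: (@frob_inj K charK 1).
have := max_poly_roots P0 _ (_ : uniq (map (fun x : K => x ^+ 2) t)).
rewrite map_inj_uniq // size_map => /(_ _ ut) lt.
have : (size t < size P)%N.
  by apply: lt; apply/allP => _ /mapP [x xt ->]; exact: rootP.
move=> lt'; have := leq_trans lt' sP; rewrite ltnS => /leq_trans; apply.
(* [s(s-1)] is twice the binomial, so the degree bound is [(4d+2)e], at most the stated one. *)
have := mul_bin_diag s 1; rewrite bin1 => sb.
rewrite [(s.-1 * s)%N]mulnC sb mulnA leq_mul2r; apply/orP; right.
by rewrite /m; lia.
Qed.
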